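(* Let $\mathcal{C}$ be a strict monoidal category, $(A,\mu,u)$ an algebra in $\mathcal{C}$ with multiplication $\mu$ and unit $u$, and $T:A\otimes A\to A\otimes A$ a morphism in $\mathcal{C}$ such that $T\circ(u\otimes A)=u\otimes A$ and $T\circ(A\otimes u)=A\otimes u$. Assume that there exist two morphisms $\tilde{T}_1,\tilde{T}_2:A\otimes A\otimes A\to A\otimes A\otimes A$ in $\mathcal{C}$ such that $$(A\otimes\mu)\circ\tilde{T}_1\circ(T\otimes A)=T\circ(A\otimes\mu),$$ $$(\mu\otimes A)\circ\tilde{T}_2\circ(A\otimes T)=T\circ(\mu\otimes A),$$ $$\tilde{T}_1\circ(T\otimes A)\circ(A\otimes T)=\tilde{T}_2\circ(A\otimes T)\circ(T\otimes A).$$ Then $(A,\mu\circ T,u)$ is also an algebra in $\mathcal{C}$.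
   Context: The identity morphism of an object $A$ is denoted by $A$. An algebra in a monoidal category means an associative unital algebra (monoid object). A morphism $T$ as in the statement is called a pseudotwistor for $A$, with companions $\tilde{T}_1,\tilde{T}_2$; the new algebra is denoted $A^T$. *)

(* Defs.v *)
Set Implicit Arguments.
Unset Strict Implicit.
Unset Printing Implicit Defensive.

Record Category : Type := {
  ob :> Type;
  hom : ob -> ob -> Type;
  idm : forall X : ob, hom X X;
  comp : forall X Y Z : ob, hom Y Z -> hom X Y -> hom X Z;
  comp_id_l : forall (X Y : ob) (f : hom X Y), comp (idm Y) f = f;
  comp_id_r : forall (X Y : ob) (f : hom X Y), comp f (idm X) = f;
  comp_assoc : forall (X Y Z W : ob) (h : hom Z W) (g : hom Y Z) (f : hom X Y),
    comp h (comp g f) = comp (comp h g) f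
}.

Arguments hom {c} X Y.
Arguments idm {c} X.
Arguments comp {c X Y Z} g f.

Declare Scope ob_scope.
Declare Scope mor_scope.
Delimit Scope ob_scope with ob.
Delimit Scope mor_scope with mor.
Bind Scope ob_scope with ob.
Bind Scope mor_scope with hom.
Arguments hom {c} (X Y)%_ob.
Arguments idm {c} X%_ob.

Notation "g ∘ f" := (comp g f) (at level 40, left associativity) : mor_scope.

(* The identity morphism of X, viewed as a morphism X -> Y when X and Y are
   equal objects.  Object equalities such as (X ⊗ Y) ⊗ Z = X ⊗ (Y ⊗ Z) are
   propositional and do not identify the corresponding hom-types, so these
   identities have to be written explicitly. *)
Definition id_along {C : Category} {X Y : C} (e : X = Y) : hom X Y :=
  match e in _ = Y' return hom X Y' with eq_refl => idm X end.

(* The last three fields say that the associator and the unitors, being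
   identities, are natural.  The pentagon and triangle only involve identities
   along equalities of objects, so they hold by uniqueness of identity proofs
   and are not required as axioms. *)
Record StrictMonoidalCategory : Type := {
  category :> Category;
  tens : category -> category -> category;
  unit_ob : category;
  tens_mor : forall X X' Y Y' : category,
    hom X X' -> hom Y Y' -> hom (tens X Y) (tens X' Y');
  tens_mor_id : forall X Y : category,
    tens_mor (idm X) (idm Y) = idm (tens X Y);
  tens_mor_comp : forall (X X' X'' Y Y' Y'' : category)
      (f' : hom X' X'') (f : hom X X') (g' : hom Y' Y'') (g : hom Y Y'),
    tens_mor (comp f' f) (comp g' g) = comp (tens_mor f' g') (tens_mor f g);
  tens_assoc : forall X Y Z : category,
    tens (tens X Y) Z = tens X (tens Y Z);
  tens_unit_l : forall X : category, tens unit_ob X = X;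
  tens_unit_r : forall X : category, tens X unit_ob = X;
  tens_mor_assoc : forall (X X' Y Y' Z Z' : category)
      (f : hom X X') (g : hom Y Y') (h : hom Z Z'),
    comp (id_along (tens_assoc X' Y' Z')) (tens_mor (tens_mor f g) h)
    = comp (tens_mor f (tens_mor g h)) (id_along (tens_assoc X Y Z));
  tens_mor_unit_l : forall (X X' : category) (f : hom X X'),
    comp (id_along (tens_unit_l X')) (tens_mor (idm unit_ob) f)
    = comp f (id_along (tens_unit_l X));
  tens_mor_unit_r : forall (X X' : category) (f : hom X X'),
    comp (id_along (tens_unit_r X')) (tens_mor f (idm unit_ob))
    = comp f (id_along (tens_unit_r X))
}.

Arguments tens {s} (X Y)%_ob.
Arguments unit_ob {s}.
Arguments tens_mor {s X X' Y Y'} (f g)%_mor.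

Notation "X ⊗ Y" := (tens X Y) (at level 36, left associativity) : ob_scope.
Notation "f ⊗ g" := (tens_mor f g) (at level 36, left associativity) : mor_scope.

(* Identity of X ⊗ Y ⊗ Z, between its two bracketings. *)
Definition rassoc {C : StrictMonoidalCategory} (X Y Z : C) :
    hom ((X ⊗ Y) ⊗ Z) (X ⊗ (Y ⊗ Z)) :=
  id_along (tens_assoc X Y Z).

Definition lassoc {C : StrictMonoidalCategory} (X Y Z : C) :
    hom (X ⊗ (Y ⊗ Z)) ((X ⊗ Y) ⊗ Z) :=
  id_along (eq_sym (tens_assoc X Y Z)).

Arguments rassoc {C} (X Y Z)%_ob.
Arguments lassoc {C} (X Y Z)%_ob.

Record is_algebra {C : StrictMonoidalCategory} (A : C)
    (mu : hom (A ⊗ A) A) (u : hom unit_ob A) : Prop := {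
  mul_assoc :
    (mu ∘ (mu ⊗ idm A) = mu ∘ (idm A ⊗ mu) ∘ rassoc A A A)%mor;
  mul_unit_l : (mu ∘ (u ⊗ idm A))%mor = id_along (tens_unit_l A);
  mul_unit_r : (mu ∘ (idm A ⊗ u))%mor = id_along (tens_unit_r A)
}.

(* A ⊗ f for f : Y ⊗ Z -> Y' ⊗ Z', as a morphism between the left-bracketed
   triple tensor products. *)
Definition lwhisker {C : StrictMonoidalCategory} (A : C) {Y Z Y' Z' : C}
    (f : hom (Y ⊗ Z) (Y' ⊗ Z')) : hom (A ⊗ Y ⊗ Z) (A ⊗ Y' ⊗ Z') :=
  (lassoc A Y' Z' ∘ (idm A ⊗ f) ∘ rassoc A Y Z)%mor.

(* Main.v *)
(** The companions [T1] and [T2] push [T] past [mu]: each bracketing of the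
    twisted triple product is an untwisted triple product precomposed with one
    side of the Yang-Baxter-like relation [T1_T2], so that the associativity
    of [mu] carries over. *)

Require Import Defs.

Local Open Scope mor_scope.

Lemma id_along_sym_r {C : Category} {X Y : C} (e : X = Y) :
  id_along e ∘ id_along (eq_sym e) = idm Y.
Proof. destruct e; apply comp_id_l. Qed.

(** The outer [lassoc] of [lwhisker] cancels against [rassoc]. The hypotheses whisker [T] in the
    left bracketing, whereas [mul_assoc] applies [idm A ⊗ T] after [rassoc]. *)
Lemma rassoc_lwhisker {C : StrictMonoidalCategory} (A : C) {Y Z Y' Z' : C}
    (f : hom (Y ⊗ Z) (Y' ⊗ Z')) :
  rassoc A Y' Z' ∘ lwhisker A f = (idm A ⊗ f) ∘ rassoc A Y Z.
Proof.
  unfold lwhisker, rassoc, lassoc.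
  now rewrite !comp_assoc, id_along_sym_r, comp_id_l.
Qed.

Lemma tens_mor_comp_idr {C : StrictMonoidalCategory} {X X' X'' : C} (A : C)
    (g : hom X' X'') (f : hom X X') :
  (g ∘ f) ⊗ idm A = (g ⊗ idm A) ∘ (f ⊗ idm A).
Proof. now rewrite <- tens_mor_comp, comp_id_l. Qed.

Lemma tens_mor_comp_idl {C : StrictMonoidalCategory} {X X' X'' : C} (A : C)
    (g : hom X' X'') (f : hom X X') :
  idm A ⊗ (g ∘ f) = (idm A ⊗ g) ∘ (idm A ⊗ f).
Proof. now rewrite <- tens_mor_comp, comp_id_l. Qed.

Theorem proposition6p1
  (C : StrictMonoidalCategory) (A : C)
  (mu : hom (A ⊗ A) A) (u : hom unit_ob A) (algA : is_algebra mu u)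
  (T : hom (A ⊗ A) (A ⊗ A))
  (T_unit_l : T ∘ (u ⊗ idm A) = u ⊗ idm A)
  (T_unit_r : T ∘ (idm A ⊗ u) = idm A ⊗ u)
  (T1 T2 : hom (A ⊗ A ⊗ A) (A ⊗ A ⊗ A))
  (T1_mu : (idm A ⊗ mu) ∘ rassoc A A A ∘ T1 ∘ (T ⊗ idm A)
           = T ∘ (idm A ⊗ mu) ∘ rassoc A A A)
  (T2_mu : (mu ⊗ idm A) ∘ T2 ∘ lwhisker A T = T ∘ (mu ⊗ idm A))
  (T1_T2 : T1 ∘ (T ⊗ idm A) ∘ lwhisker A T
           = T2 ∘ lwhisker A T ∘ (T ⊗ idm A)) :
  is_algebra (mu ∘ T) u.
Proof.
  destruct algA as [assoc unit_l unit_r]; split.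
  - rewrite tens_mor_comp_idr, tens_mor_comp_idl.
    (* [T2_mu], read from right to left, moves the outer [T] before [mu ⊗ idm A] and exposes the
       right side of [T1_T2]. *)
    transitivity
      (mu ∘ (mu ⊗ idm A) ∘ (T2 ∘ lwhisker A T ∘ (T ⊗ idm A))).
    { rewrite <- (comp_assoc mu T), (comp_assoc T), <- T2_mu.
      now rewrite !comp_assoc. }
    rewrite <- T1_T2, assoc.
    (* With [mu] reassociated, the factors regroup around the left side of [T1_mu], which brings [T]
       back next to the outer [mu]. *)
    transitivity
      (mu ∘ ((idm A ⊗ mu) ∘ rassoc A A A ∘ T1 ∘ (T ⊗ idm A))
       ∘ lwhisker A T).
    { now rewrite !comp_assoc. }
    rewrite T1_mu, <- !comp_assoc.
    now rewrite rassoc_lwhisker.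
  - now rewrite <- comp_assoc, T_unit_l.
  - now rewrite <- comp_assoc, T_unit_r.
Qed.
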